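(* Let $(B,+,\circ)$ and $(C,+',\circ')$ be two left $RG$-semibraces and let $(B,C,\alpha,\beta)$ be a matched product system of the left $RG$-semibraces $B$ and $C$ via $\alpha$ and $\beta$. Then $B\times C$ endowed with the operations $$(a,u)\,\hat{+}\,(b,v):=(a+b,\;u+'v),$$ $$(a,u)\,\hat{\circ}\,(b,v):=\left(\alpha_u\left(\alpha_u^{-1}(a)\circ b\right),\;\beta_a\left(\beta_a^{-1}(u)\circ' v\right)\right),$$ for all $(a,u),(b,v)\in B\times C$, is a left $RG$-semibrace.
   Context: A right group is a non-empty semigroup $(S,\cdot)$ such that for all $a,b\in S$ there is a unique $x\in S$ with $a\cdot x=b$. A left $RG$-semibrace is a triplet $(B,+,\circ)$ where $+,\circ$ are binary operations on the set $B$ such that $(B,+)$ and $(B,\circ)$ are both right groups and $a\circ(b+c)=a\circ b+(-a+a\circ c)$ for all $a,b,c\in B$, where $-a+a\circ c$ denotes the unique $x\in B$ such that $a+x=a\circ c$. In any left $RG$-semibrace $(B,+,\circ)$, $\lambda_a:B\to B$ denotes the map sending $b$ to the unique $x\in B$ with $a+x=a\circ b$; for $(C,+',\circ')$ the analogous maps are also denoted $\lambda_u$, $u\in C$. A matched product system of the left $RG$-semibraces $(B,+,\circ)$ and $(C,+',\circ')$ via $\alpha$ and $\beta$ is a quadruple $(B,C,\alpha,\beta)$ where $\alpha:C\to\mathrm{Aut}(B,+)$, $u\mapsto \alpha_u$, is a semigroup homomorphism from $(C,\circ')$ into the automorphism group of the semigroup $(B,+)$, and $\beta:B\to\mathrm{Aut}(C,+')$,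 $a\mapsto\beta_a$, is a semigroup homomorphism from $(B,\circ)$ into the automorphism group of the semigroup $(C,+')$, such that for all $a\in B$ and $u\in C$ $$\alpha_u\lambda_a=\lambda_{\alpha_u(a)}\,\alpha_{\beta^{-1}_{\alpha_u(a)}(u)}\qquad\text{and}\qquad \beta_a\lambda_u=\lambda_{\beta_a(u)}\,\beta_{\alpha^{-1}_{\beta_a(u)}(a)}.$$ Here $\alpha_u^{-1}=(\alpha_u)^{-1}$ and $\beta_a^{-1}=(\beta_a)^{-1}$ are the inverse maps, and juxtaposition of maps is composition. *)

(* Defs.v *)
From mathcomp Require Import all_boot.
From Stdlib Require Import ClassicalEpsilon.

Set Implicit Arguments.
Unset Strict Implicit.
Unset Printing Implicit Defensive.

Definition semigroup (S : Type) (op : S -> S -> S) : Prop := associative op.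

Definition right_group (S : Type) (op : S -> S -> S) : Prop :=
  [/\ inhabited S, semigroup op & forall a b : S, exists! x : S, op a x = b].

(* When [op] is a right group operation, this is the unique [x] with
   [op a x = b], written [-a + b] in additive notation. The description
   operator makes it a total function; its value is only meaningful when such
   an [x] exists. *)
Definition ldiv (S : Type) (op : S -> S -> S) (a b : S) : S :=
  epsilon (inhabits a) (fun x : S => op a x = b).

Record left_RG_semibrace (B : Type) (add circ : B -> B -> B) : Prop :=
  LeftRGSemibrace {
    semibrace_add : right_group add;
    semibrace_circ : right_group circ;
    semibrace_distr : forall a b c : B,
      circ a (add b c) = add (circ a b) (ldiv add a (circ a c))
  }.

Definition lambda (B : Type) (add circ : B -> B -> B) (a b : B) : B :=
  ldiv add a (circ a b).

(* The inverse map is carried as data, but it is determined by [aut_fun]. *)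
Record semigroup_aut (S : Type) (op : S -> S -> S) : Type := SemigroupAut {
  aut_fun :> S -> S;
  aut_inv : S -> S;
  aut_morph : {morph aut_fun : x y / op x y};
  aut_funK : cancel aut_fun aut_inv;
  aut_invK : cancel aut_inv aut_fun
}.

(* Homomorphism into the group of automorphisms of [(S, op)], whose product is
   composition of maps. *)
Definition aut_hom (T S : Type) (opT : T -> T -> T) (op : S -> S -> S)
    (f : T -> semigroup_aut op) : Prop :=
  forall t t' : T, f (opT t t') =1 f t \o f t'.

Record matched_product_system (B C : Type)
    (addB circB : B -> B -> B) (addC circC : C -> C -> C)
    (alpha : C -> semigroup_aut addB) (beta : B -> semigroup_aut addC) : Prop :=
  MatchedProductSystem {
    mps_alpha : aut_hom circC alpha;
    mps_beta : aut_hom circB beta;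
    mps_alpha_lambda : forall (a : B) (u : C),
      alpha u \o lambda addB circB a =1
      lambda addB circB (alpha u a) \o alpha (aut_inv (beta (alpha u a)) u);
    mps_beta_lambda : forall (a : B) (u : C),
      beta a \o lambda addC circC u =1
      lambda addC circC (beta a u) \o beta (aut_inv (alpha (beta a u)) a)
  }.

Definition matched_add (B C : Type) (addB : B -> B -> B) (addC : C -> C -> C)
    (p q : B * C) : B * C :=
  (addB p.1 q.1, addC p.2 q.2).

Definition matched_circ (B C : Type)
    (addB circB : B -> B -> B) (addC circC : C -> C -> C)
    (alpha : C -> semigroup_aut addB) (beta : B -> semigroup_aut addC)
    (p q : B * C) : B * C :=
  let: (a, u) := p in let: (b, v) := q in
  (alpha u (circB (aut_inv (alpha u) a) b),
   beta a (circC (aut_inv (beta a) u) v)).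

(* Main.v *)
Require Import Defs.
From mathcomp Require Import all_boot.

(** A left RG-semibrace is the same thing as a right group [(S, +)] with a family
    of additive automorphisms [L p] satisfying the cocycle identity
    [L (p + L p q) = L p \o L q]; the multiplication is then
    [p o q = p + L p q], and [L] is the lambda map. One direction is
    [lambda_morph_add], [lambda_circ] and [lambda_bij], the other is
    [semibrace_of_cocycle].

    So it is enough to find such a family on [B * C] with its componentwise sum.
    Writing [a' = alpha_u^-1 a] and [u' = beta_a^-1 u], and using that [alpha_u] is
    additive, the first component of [(a, u) o (b, v)] is
    [a + alpha_u (lambda_a' b)], and symmetrically for the second one. Hence
    the first component of [L (a, u)] is [alpha_u \o lambda_a'], an
    automorphism, and the matching condition rewrites it as
    [lambda_a \o alpha_u']. Going back and forth between these two forms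
    gives the cocycle identity ([matched_lambda_circ]):
    [lambda_a alpha_u' alpha_v lambda_b' = lambda_a alpha_(u' o v) lambda_b'], where
    [b' = alpha_v^-1 b]; moving [alpha_(u' o v)] to the right of [lambda_b']
    turns this into [lambda_(a o alpha_u' b)] after a single [alpha], which is
    the second form for the product [(a, u) o (b, v)]. The second component
    follows by exchanging [B] and [C], under which matched product systems are
    stable. *)

Set Implicit Arguments.
Unset Strict Implicit.
Unset Printing Implicit Defensive.

Section RightGroup.

Variables (S : Type) (op : S -> S -> S).
Hypothesis rgS : right_group op.

Lemma right_group_assoc : associative op.
Proof. by case: rgS. Qed.

Lemma op_ldiv a b : op a (ldiv op a b) = b.
Proof.
case: rgS => _ _ /(_ a b) [x [Hx _]].
by apply: (ClassicalEpsilon.epsilon_spec (inhabits a) (fun x => op a x = b)); exists x.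
Qed.

Lemma right_group_cancel a : injective (op a).
Proof.
move=> x y Hxy; case: rgS => _ _ /(_ a (op a y)) [z [_ Hz]].
by rewrite -(Hz x Hxy) -(Hz y erefl).
Qed.

Lemma ldiv_unique a b x : op a x = b -> ldiv op a b = x.
Proof. by move=> Hx; apply: (@right_group_cancel a); rewrite op_ldiv. Qed.

Lemma idempotent_left_id e : op e e = e -> left_id e op.
Proof.
by move=> He x; apply: (@right_group_cancel e); rewrite right_group_assoc He.
Qed.

(** The solution [e] of [a e = a] is the identity of a subgroup containing [a]. *)
Lemma right_group_inverse a :
  exists b e, [/\ op e e = e, op a b = e & op b a = e].
Proof.
have He : op (ldiv op a a) (ldiv op a a) = ldiv op a a.
  by apply: (@right_group_cancel a); rewrite right_group_assoc !op_ldiv.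
exists (ldiv op a (ldiv op a a)), (ldiv op a a); split=> //; rewrite ?op_ldiv //.
apply: (@right_group_cancel a).
by rewrite right_group_assoc !op_ldiv (idempotent_left_id He).
Qed.

End RightGroup.

Lemma prod_right_group (B C : Type) (addB : B -> B -> B) (addC : C -> C -> C) :
  right_group addB -> right_group addC -> right_group (matched_add addB addC).
Proof.
move=> rgB rgC; split.
- by case: rgB rgC => [[b] _ _] [[c] _ _]; exists; exact: (b, c).
- move=> [a u] [b v] [c w]; rewrite /matched_add /=.
  by rewrite (right_group_assoc rgB) (right_group_assoc rgC).
- move=> [a u] [b v]; exists (ldiv addB a b, ldiv addC u v); split.
    by rewrite /matched_add /= (op_ldiv rgB) (op_ldiv rgC).
  by move=> [x y] [Hx Hy]; rewrite (ldiv_unique rgB Hx) (ldiv_unique rgC Hy).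
Qed.

(** Associativity holds because both bracketings of [p q r] equal
    [p + L p q + L p (L q r)], and left division by [p] is subtraction of [p]
    followed by the inverse of [L p]. *)
Lemma semibrace_of_cocycle (S : Type) (add circ : S -> S -> S) (L : S -> S -> S) :
  right_group add ->
  (forall p q, circ p q = add p (L p q)) ->
  (forall p, {morph L p : q r / add q r}) ->
  (forall p, bijective (L p)) ->
  (forall p q, L (circ p q) =1 L p \o L q) ->
  left_RG_semibrace add circ.
Proof.
move=> rg circE LD Lbij Lcirc; have addA := right_group_assoc rg.
split=> //.
- split; first by case: rg.
    by move=> p q r; rewrite [RHS]circE Lcirc !circE LD addA.
  move=> p q; case: (Lbij p) => g Lg gL.
  exists (g (ldiv add p q)); split; first by rewrite circE gL (op_ldiv rg).
  by move=> r; rewrite circE => /(ldiv_unique rg) ->; rewrite Lg.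
- move=> p q r; rewrite !circE LD addA; congr (add _ _).
  by apply/esym/(ldiv_unique rg).
Qed.

Section Lambda.

Variables (B : Type) (add circ : B -> B -> B).
Hypothesis brB : left_RG_semibrace add circ.
Let rg_add := semibrace_add brB.
Let rg_circ := semibrace_circ brB.
Local Notation lam := (lambda add circ).

Lemma circ_lambda a b : circ a b = add a (lam a b).
Proof. by rewrite /lambda (op_ldiv rg_add). Qed.

Lemma lambda_morph_add a : {morph lam a : b c / add b c}.
Proof.
move=> b c; apply: (ldiv_unique rg_add).
by rewrite (right_group_assoc rg_add) -circ_lambda (semibrace_distr brB).
Qed.

Lemma lambda_circ a b : lam (circ a b) =1 lam a \o lam b.
Proof.
move=> c; apply: (ldiv_unique rg_add) => /=.
rewrite -(right_group_assoc rg_circ) (circ_lambda b c) (semibrace_distr brB).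
by [].
Qed.

(** [lam e] is idempotent because [e] is, and injective because
    [e + lam e b = e o b = b]. *)
Lemma lambda_idempotent e : circ e e = e -> lam e =1 id.
Proof.
move=> He b.
have inj_e : injective (lam e).
  move=> x y Hxy; rewrite -(idempotent_left_id rg_circ He x) circ_lambda Hxy.
  by rewrite -circ_lambda (idempotent_left_id rg_circ He).
by apply: inj_e; rewrite -[LHS](lambda_circ e e b) He.
Qed.

Lemma lambda_bij a : bijective (lam a).
Proof.
have [b [e [He ab ba]]] := right_group_inverse rg_circ a.
exists (lam b) => x.
- by rewrite -[LHS](lambda_circ b a x) ba lambda_idempotent.
- by rewrite -[LHS](lambda_circ a b x) ab lambda_idempotent.
Qed.

End Lambda.

Lemma matched_product_system_sym (B C : Type)
    (addB circB : B -> B -> B) (addC circC : C -> C -> C)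
    (alpha : C -> semigroup_aut addB) (beta : B -> semigroup_aut addC) :
  matched_product_system circB circC alpha beta ->
  matched_product_system circC circB beta alpha.
Proof. by case=> *; split. Qed.

Section MatchedLambda.

Variables (B C : Type) (addB circB : B -> B -> B) (addC circC : C -> C -> C).
Variables (alpha : C -> semigroup_aut addB) (beta : B -> semigroup_aut addC).
Hypothesis brB : left_RG_semibrace addB circB.
Hypothesis mps : matched_product_system circB circC alpha beta.

(** First component of the lambda map of the matched product. *)
Definition matched_lambda (a : B) (u : C) (b : B) : B :=
  alpha u (lambda addB circB (aut_inv (alpha u) a) b).

Lemma matched_lambdaE a u b :
  matched_lambda a u b = lambda addB circB a (alpha (aut_inv (beta a) u) b).
Proof.
have /= := mps_alpha_lambda mps (aut_inv (alpha u) a) u b.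
by rewrite aut_invK.
Qed.

Lemma matched_lambda_morph_add a u : {morph matched_lambda a u : b c / addB b c}.
Proof.
by move=> b c; rewrite /matched_lambda (lambda_morph_add brB) aut_morph.
Qed.

Lemma matched_lambda_bij a u : bijective (matched_lambda a u).
Proof.
apply: (@bij_comp _ _ _ (alpha u)); last exact: lambda_bij.
by exists (aut_inv (alpha u)); [exact: aut_funK | exact: aut_invK].
Qed.

Lemma matched_circ_lambda a u b :
  alpha u (circB (aut_inv (alpha u) a) b) = addB a (matched_lambda a u b).
Proof. by rewrite (circ_lambda brB) aut_morph aut_invK. Qed.

(** Since the right-hand side is a [circB]-product with left factor [a], the
    homomorphisms [lambda] and [beta] split on it; they do not on the left-hand
    side, where [alpha u] is outermost. *)
Lemma matched_circE a u b :
  alpha u (circB (aut_inv (alpha u) a) b) =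
  circB a (alpha (aut_inv (beta a) u) b).
Proof. by rewrite matched_circ_lambda matched_lambdaE -(circ_lambda brB). Qed.

Lemma matched_lambda_circ a u b v :
  matched_lambda (alpha u (circB (aut_inv (alpha u) a) b))
                 (beta a (circC (aut_inv (beta a) u) v)) =1
  matched_lambda a u \o matched_lambda b v.
Proof.
move=> c /=; set u' := aut_inv (beta a) u.
rewrite [LHS]matched_lambdaE matched_circE -/u' [RHS]matched_lambdaE -/u'.
rewrite (lambda_circ brB) /=; congr (lambda _ _ _ _).
(* [beta] of the product is [beta a \o beta (alpha u' b)], which cancels the
   outer [beta a] in the second component. *)
have -> : aut_inv (beta (circB a (alpha u' b))) (beta a (circC u' v)) =
          aut_inv (beta (alpha u' b)) (circC u' v).
  apply: (can_inj (aut_funK (beta (circB a (alpha u' b))))).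
  by rewrite aut_invK (mps_beta mps) /= aut_invK.
rewrite -matched_lambdaE /matched_lambda (mps_alpha mps) /=.
congr (alpha u' (alpha v (lambda _ _ _ _))).
apply: (can_inj (aut_funK (alpha (circC u' v)))).
by rewrite aut_invK (mps_alpha mps) /= aut_invK.
Qed.

End MatchedLambda.

Theorem theorem2p14 (B C : Type)
    (addB circB : B -> B -> B) (addC circC : C -> C -> C)
    (alpha : C -> semigroup_aut addB) (beta : B -> semigroup_aut addC) :
  left_RG_semibrace addB circB ->
  left_RG_semibrace addC circC ->
  matched_product_system circB circC alpha beta ->
  left_RG_semibrace (matched_add addB addC) (matched_circ circB circC alpha beta).
Proof.
move=> brB brC mps; have mps' := matched_product_system_sym mps.
pose L1 := matched_lambda circB alpha; pose L2 := matched_lambda circC beta.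
pose L (p q : B * C) := (L1 p.1 p.2 q.1, L2 p.2 p.1 q.2).
apply: (@semibrace_of_cocycle _ _ _ L).
- exact: prod_right_group (semibrace_add brB) (semibrace_add brC).
- by move=> [a u] [b v]; congr pair; apply: matched_circ_lambda.
- by move=> [a u] [b v] [c w]; congr pair; apply: matched_lambda_morph_add.
- move=> [a u]; have [f fK Kf] := matched_lambda_bij alpha brB a u.
  have [g gK Kg] := matched_lambda_bij beta brC u a.
  exists (fun q : B * C => (f q.1, g q.2)) => -[b v];
    rewrite /L /L1 /L2 /=; congr pair; by [exact: fK | exact: gK | exact: Kf | exact: Kg].
- move=> [a u] [b v] [c w]; congr pair.
    exact: (matched_lambda_circ brB mps).
  exact: (matched_lambda_circ brC mps').
Qed.
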